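(* Let $(\mathcal{M},\mathbf{g},G_{n})$ be an $n$-dimensional locally homogeneous space whose Killing vector fields $\boldsymbol{\xi}_{1},\ldots,\boldsymbol{\xi}_{n}$ span the Lie algebra $\mathfrak{g}_{n}$ with structure constants $C^{M}{}_{AB}$, i.e. $[\boldsymbol{\xi}_{A},\boldsymbol{\xi}_{B}]=C^{M}{}_{AB}\boldsymbol{\xi}_{M}$. Let $\{\mathbf{X}_{A}\}$ be the associated invariant frame and $\{\boldsymbol{\sigma}^{A}\}$ its dual coframe, defined over $\mathcal{K}$, and let the first fundamental form be $$g_{\text{red.}}=h_{AB}\,\boldsymbol{\sigma}^{A}\otimes\boldsymbol{\sigma}^{B},$$ defined throughout $\bigcup_{q\in\mathcal{K}}T^{*}_{q}(\mathcal{M})$, where the frame metric $h_{AB}$ is constant on $\mathcal{M}$ (possibly depending on outer variables). Then a class of irreducible frame metrics (in the sense defined in the context) is given, in infinitesimal form (that is, to first order in the small parameters), by the family $$\{\,h_{AB}+h_{AM}C^{M}{}_{NB}\,\varepsilon^{N}+h_{MB}C^{M}{}_{NA}\,\varepsilon^{N}\,\},$$ where $\{\varepsilon^{N}\}$ is a collection of at most $n$ functions depending on the outer variables of $\mathbf{h}$ (if any), multiplied by parameters close to zero.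
   Context: Conventions: capital indices run over $\{1,\ldots,n\}$; repeated indices are summed; $\pounds$ is the Lie derivative and $\lrcorner$ is contraction. Locally homogeneous space: a structure $(\mathcal{M},\mathbf{g},G_{n})$ where $\mathcal{M}$ is an $n$-dimensional, simply connected, Hausdorff, $C^{\infty}$ manifold; $\mathbf{g}$ is a $C^{m}$ metric tensor field on $\mathcal{M}$ (non-degenerate, covariant of order 2) such that at each point there is a frame $\{\mathbf{e}_{A}\}$ with $\mathbf{g}(\mathbf{e}_{A},\mathbf{e}_{B})=h_{AB}$, where $h_{AB}$ is a symmetric matrix of Euclidean (positive definite) signature; and $G_{n}$ is a local Lie group of transformations, with real Lie algebra $\mathfrak{g}_{n}$, acting simply transitively on $\mathcal{M}$. The algebra $\mathfrak{g}_{n}$ is spanned by Killing vector fields $\{\boldsymbol{\xi}_{A}\}$, $\pounds_{\boldsymbol{\xi}_{A}}\mathbf{g}=0$. Invariant frame and coframe: $\{\mathbf{X}_{A}\}$ is the basis of the Lie algebra of the reciprocal group, determined by $[\boldsymbol{\xi}_{A},\mathbf{X}_{B}]=0$ and $[\mathbf{X}_{A},\mathbf{X}_{B}]=-C^{M}{}_{AB}\mathbf{X}_{M}$ for all $A,B$. The set $\mathcal{K}\subseteq\mathcal{M}$ is a neighbourhood of a given point (containing the points that correspond to the identity group element) on which neither the $\boldsymbol{\xi}_{A}$ nor the $\mathbf{X}_{A}$ have singular points, so that $\{\mathbf{X}_{A}\}$ is a frame over $\mathcal{K}$. The dual coframe $\{\boldsymbol{\sigma}^{A}\}$ satisfies $\mathbf{X}_{A}\lrcorner\boldsymbol{\sigma}^{B}=\delta_{A}{}^{B}$,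 and hence $\pounds_{\boldsymbol{\xi}_{A}}\boldsymbol{\sigma}^{B}=0$. Outer variables: variables unrelated to $\mathcal{M}$ (for example a time parameter) on which $h_{AB}$ may depend; with respect to $\mathcal{M}$, $dh_{AB}=0$. Equivalent frame metrics: let $S=(S^{A}{}_{B})$ be an invertible matrix preserving the structure constants, $S^{A}{}_{B}C^{B}{}_{MN}=C^{A}{}_{KL}S^{K}{}_{M}S^{L}{}_{N}$. Replacing $\boldsymbol{\sigma}^{A}$ by $\widetilde{\boldsymbol{\sigma}}^{A}=S^{A}{}_{B}\boldsymbol{\sigma}^{B}$ and writing $g_{\text{red.}}=\widetilde{h}_{MN}\widetilde{\boldsymbol{\sigma}}^{M}\otimes\widetilde{\boldsymbol{\sigma}}^{N}$ gives $\widetilde{h}_{MN}=h_{AB}(S^{-1})^{A}{}_{M}(S^{-1})^{B}{}_{N}$. To first order near the identity, $S^{A}{}_{B}\simeq\delta^{A}{}_{B}+w^{\alpha}\lambda^{A}{}_{(\alpha)B}$ with $w^{\alpha}\to0$, where each generator $\lambda=\lambda_{(\alpha)}$ satisfies $\lambda^{A}{}_{B}C^{B}{}_{MN}=\lambda^{Q}{}_{M}C^{A}{}_{QN}+\lambda^{Q}{}_{N}C^{A}{}_{MQ}$, and then $\widetilde{h}_{AB}\simeq h_{AB}-h_{AM}\lambda^{M}{}_{(\alpha)B}w^{\alpha}-h_{MB}\lambda^{M}{}_{(\alpha)A}w^{\alpha}$. Class of irreducible frame metrics, in infinitesimal form: ''irreducible'' means free of spurious degrees of freedom, i.e. considered modulo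 those changes of the frame metric that are induced by coordinate transformations. Concretely, the class is the family of all first-order expressions $\widetilde{h}_{AB}$ as in the previous paragraph for which each generator $\lambda_{(\alpha)}$ is induced by an infinitesimal general coordinate transformation $\widetilde{x}^{a}=x^{a}+w^{\alpha}\Pi^{a}{}_{\alpha}(x)$, i.e. $\pounds_{\boldsymbol{\Pi}_{\alpha}}\boldsymbol{\sigma}^{A}=\lambda^{A}{}_{(\alpha)B}\boldsymbol{\sigma}^{B}$ over $\mathcal{K}$. Here $\boldsymbol{\Pi}_{\alpha}=\Sigma^{A}{}_{\alpha}\mathbf{X}_{A}$ is a linear combination whose coefficients are constant on $\mathcal{M}$ (possibly depending on the outer variables); equivalently, these generators satisfy $\pounds_{\boldsymbol{\Pi}_{\alpha}}\boldsymbol{\xi}_{A}=0$, so the transformation preserves the form of the given Killing vector fields. *)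

(* Defs.v *)
From HB Require Import structures.
From mathcomp Require Import all_boot all_order all_algebra.
From mathcomp Require Import all_classical all_reals all_analysis.

Set Implicit Arguments.
Unset Strict Implicit.
Unset Printing Implicit Defensive.

Import Order.TTheory GRing.Theory Num.Theory.
Import numFieldNormedType.Exports.

Local Open Scope classical_set_scope.
Local Open Scope ring_scope.

(* [f] is of class C^k on [U] ([U] is meant to be open). *)
Fixpoint Ck (R : realType) (V W : normedModType R) (k : nat) (U : set V)
    (f : V -> W) : Prop :=
  match k with
  | 0 => forall x, U x -> {for x, continuous f}
  | k'.+1 => (forall x, U x -> differentiable f x) /\
             (forall v, Ck k' U (fun x => 'D_v f x))
  end.

Definition smooth_map (R : realType) (V W : normedModType R) (U : set V)
    (f : V -> W) : Prop :=
  forall k, Ck k U f.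

Definition simply_connected (R : realType) (M : topologicalType) : Prop :=
  (forall x y : M, exists c : R -> M,
     [/\ {within `[(0:R), 1]%classic, continuous c}, c 0 = x & c 1 = y]) /\
  (forall c : R -> M, {within `[(0:R), 1]%classic, continuous c} -> c 0 = c 1 ->
   exists H : R * R -> M,
     [/\ {within `[(0:R), 1]%classic `*` `[(0:R), 1]%classic, continuous H},
         forall s, `[(0:R), 1]%classic s -> H (0, s) = c s /\ H (1, s) = c 0
       & forall u, `[(0:R), 1]%classic u -> H (u, 0) = c 0 /\ H (u, 1) = c 0]).

(* [cinv] is the inverse of the homeomorphism [cmap] from [cdom] onto its open
   image; neither map is constrained elsewhere. *)
Record chart (R : realType) (n : nat) (M : topologicalType) := Chart {
  cdom : set M;
  cmap : M -> 'rV[R]_n;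
  cinv : 'rV[R]_n -> M;
  cdom_open : open cdom;
  cimg_open : open (cmap @` cdom);
  cmapK : forall p, cdom p -> cinv (cmap p) = p;
  cmap_cts : forall p, cdom p -> {for p, continuous cmap};
  cinv_cts : forall p, cdom p -> {for cmap p, continuous cinv} }.

(* A smooth atlas, with a preferred chart around each point. *)
Record smooth_structure (R : realType) (n : nat) (M : topologicalType) :=
  SmoothStructure {
  chart_at : M -> chart R n M;
  mem_chart_at : forall p, cdom (chart_at p) p;
  chart_compat : forall p q,
    smooth_map (cmap (chart_at p) @` (cdom (chart_at p) `&` cdom (chart_at q)))
               (cmap (chart_at q) \o cinv (chart_at p)) }.

Section Calculus.
Variables (R : realType) (n : nat) (M : topologicalType).
Variable A : smooth_structure R n M.

Definition Ck_on (k : nat) (U : set M) (f : M -> R) : Prop :=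
  forall p, Ck k (cmap (chart_at A p) @` (U `&` cdom (chart_at A p)))
                 (f \o cinv (chart_at A p)).

Definition smooth_on (U : set M) (f : M -> R) : Prop := forall k, Ck_on k U f.

(* Tensors at [p] are given by their components with respect to the coordinates
   of [chart_at A p]: a tangent vector is a row, a covector a column and a
   covariant tensor of order 2 a square matrix. *)
Definition vfield := M -> 'rV[R]_n.
Definition cofield := M -> 'cV[R]_n.
Definition ctensor2 := M -> 'M[R]_n.

(* Derivative of the function [f] along the tangent vector [v] at [p]. *)
Definition dirder (p : M) (v : 'rV[R]_n) (f : M -> R) : R :=
  'D_v (f \o cinv (chart_at A p)) (cmap (chart_at A p) p).

Definition vact (X : vfield) (f : M -> R) : M -> R :=
  fun p => dirder p (X p) f.

Definition smooth_vf (U : set M) (X : vfield) : Prop :=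
  forall V f, open V -> V `<=` U -> smooth_on V f -> smooth_on V (vact X f).

(* [X, Y] = Z over U *)
Definition is_bracket (U : set M) (X Y Z : vfield) : Prop :=
  forall V f, open V -> V `<=` U -> smooth_on V f ->
    forall p, V p -> vact Z f p = vact X (vact Y f) p - vact Y (vact X f) p.

Definition contract (X : vfield) (s : cofield) : M -> R :=
  fun p => (X p *m s p) 0 0.

Definition contract2 (g : ctensor2) (X Y : vfield) : M -> R :=
  fun p => (X p *m g p *m (Y p)^T) 0 0.

Definition tensor (s t : cofield) : ctensor2 := fun p => s p *m (t p)^T.

Definition smooth_cofield (U : set M) (s : cofield) : Prop :=
  forall V Y, open V -> V `<=` U -> smooth_vf V Y -> smooth_on V (contract Y s).

Definition Ck_ctensor2 (k : nat) (g : ctensor2) : Prop :=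
  forall V X Y, open V -> smooth_vf V X -> smooth_vf V Y ->
    Ck_on k V (contract2 g X Y).

(* L_X s = t over U, where (L_X s)(Y) = X(s(Y)) - s([X, Y]); in this definition
   and the next one the primed field is the bracket with the first field, which
   always exists. *)
Definition is_lie_cofield (U : set M) (X : vfield) (s t : cofield) : Prop :=
  forall V Y Y', open V -> V `<=` U -> smooth_vf V Y -> smooth_vf V Y' ->
    is_bracket V X Y Y' ->
    forall p, V p -> contract Y t p = vact X (contract Y s) p - contract Y' s p.

(* L_X g = 0, where (L_X g)(Y, Z) = X(g(Y, Z)) - g([X, Y], Z) - g(Y, [X, Z]) *)
Definition killing (g : ctensor2) (X : vfield) : Prop :=
  forall V Y Y' Z Z', open V ->
    smooth_vf V Y -> smooth_vf V Y' -> smooth_vf V Z -> smooth_vf V Z' ->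
    is_bracket V X Y Y' -> is_bracket V X Z Z' ->
    forall p, V p ->
      vact X (contract2 g Y Z) p - contract2 g Y' Z p - contract2 g Y Z' p = 0.

Definition frame_over (U : set M) (X : 'I_n -> vfield) : Prop :=
  (forall B, smooth_vf U (X B)) /\
  (forall p, U p -> (\matrix_B X B p : 'M[R]_n) \in unitmx).

Definition dual_coframe (U : set M) (X : 'I_n -> vfield) (s : 'I_n -> cofield)
    : Prop :=
  (forall B, smooth_cofield U (s B)) /\
  (forall p, U p -> forall B D, contract (X B) (s D) p = (B == D)%:R).

End Calculus.

(* A local Lie group in coordinates centred at the identity element 0. *)
Record local_lie_group (R : realType) (n : nat) := LocalLieGroup {
  gdom : set 'rV[R]_n;
  gmul_dom : set ('rV[R]_n * 'rV[R]_n);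
  ginv_dom : set 'rV[R]_n;
  gmul : 'rV[R]_n -> 'rV[R]_n -> 'rV[R]_n;
  ginv : 'rV[R]_n -> 'rV[R]_n;
  gdom_open : open gdom;
  gdom0 : gdom 0;
  gmul_dom_open : open gmul_dom;
  gmul_dom_sub : gmul_dom `<=` gdom `*` gdom;
  gmul_dom0 : forall a, gdom a -> gmul_dom (0, a) /\ gmul_dom (a, 0);
  gmul_in : forall a b, gmul_dom (a, b) -> gdom (gmul a b);
  gmul_smooth : smooth_map gmul_dom (fun ab => gmul ab.1 ab.2);
  gmul0 : forall a, gdom a -> gmul 0 a = a /\ gmul a 0 = a;
  gmulA : forall a b c, gmul_dom (a, b) -> gmul_dom (b, c) ->
    gmul_dom (gmul a b, c) -> gmul_dom (a, gmul b c) ->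
    gmul (gmul a b) c = gmul a (gmul b c);
  ginv_dom_open : open ginv_dom;
  ginv_dom0 : ginv_dom 0;
  ginv_dom_sub : ginv_dom `<=` gdom;
  ginv_smooth : smooth_map ginv_dom ginv;
  ginvP : forall a, ginv_dom a ->
    [/\ gmul_dom (a, ginv a), gmul_dom (ginv a, a),
        gmul a (ginv a) = 0 & gmul (ginv a) a = 0] }.

Record local_action (R : realType) (n : nat) (M : topologicalType)
    (A : smooth_structure R n M) (G : local_lie_group R n) := LocalAction {
  adom : set ('rV[R]_n * M);
  act : 'rV[R]_n -> M -> M;
  adom_open : open adom;
  adom_sub : forall a p, adom (a, p) -> gdom G a;
  adom0 : forall p, adom (0, p);
  act_cts : forall ap, adom ap -> {for ap, continuous (fun bq => act bq.1 bq.2)};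
  act_smooth : forall p q,
    smooth_map
      [set ax | [/\ (cmap (chart_at A p) @` cdom (chart_at A p)) ax.2,
                    adom (ax.1, cinv (chart_at A p) ax.2)
                  & cdom (chart_at A q) (act ax.1 (cinv (chart_at A p) ax.2))]]
      (fun ax => cmap (chart_at A q) (act ax.1 (cinv (chart_at A p) ax.2)));
  act0 : forall p, act 0 p = p;
  actM : forall a b p, adom (b, p) -> adom (a, act b p) ->
    gmul_dom G (a, b) -> adom (gmul G a b, p) ->
    act a (act b p) = act (gmul G a b) p }.

(* Transitivity of a local action: the only nonempty invariant set, hence the
   only orbit, is the whole manifold. *)
Definition simply_transitive (R : realType) (n : nat) (M : topologicalType)
    (A : smooth_structure R n M) (G : local_lie_group R n)
    (Phi : local_action A G) : Prop :=
  (forall O : set M, O !=set0 ->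
     (forall a p, adom Phi (a, p) -> (O p <-> O (act Phi a p))) -> O = setT) /\
  (forall a p, adom Phi (a, p) -> act Phi a p = p -> a = 0).

Definition inf_generator (R : realType) (n : nat) (M : topologicalType)
    (A : smooth_structure R n M) (G : local_lie_group R n)
    (Phi : local_action A G) (v : 'rV[R]_n) : vfield R n M :=
  fun p => 'D_v (fun a => cmap (chart_at A p) (act Phi a p)) (0 : 'rV[R]_n).

Definition pos_def (R : realType) (n : nat) (h : 'M[R]_n) : Prop :=
  h^T = h /\ (forall v : 'rV[R]_n, v != 0 -> 0 < (v *m h *m v^T) 0 0).

(* [T] is the type of values of the outer variables ([unit] if there are
   none). [C P Q S] stands for C^P_{QS}. *)
Record locally_homogeneous (R : realType) (n m : nat) (M : topologicalType)
    (A : smooth_structure R n M) (T : Type) (g : T -> ctensor2 R n M)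
    (h : T -> 'M[R]_n) (G : local_lie_group R n) (Phi : local_action A G)
    (xi : 'I_n -> vfield R n M) (C : 'I_n -> 'I_n -> 'I_n -> R) : Prop := {
  lh_hausdorff : hausdorff_space M;
  lh_simply_connected : simply_connected R M;
  lh_metric_Cm : forall t, Ck_ctensor2 A m (g t);
  lh_metric_pos_def : forall t, pos_def (h t);
  lh_metric_frame : forall t p, exists2 e : 'M[R]_n,
    e \in unitmx & e *m g t p *m e^T = h t;
  lh_simply_transitive : simply_transitive Phi;
  lh_algebra : exists2 E : 'M[R]_n, E \in unitmx &
    forall B p, xi B p = inf_generator Phi (row B E) p;
  lh_smooth : forall B, smooth_vf A setT (xi B);
  lh_bracket : forall B D,
    is_bracket A setT (xi B) (xi D) (fun p => \sum_P C P B D *: xi P p);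
  lh_killing : forall t B, killing A (g t) (xi B) }.

Record invariant_frame (R : realType) (n : nat) (M : topologicalType)
    (A : smooth_structure R n M) (K : set M) (C : 'I_n -> 'I_n -> 'I_n -> R)
    (xi X : 'I_n -> vfield R n M) : Prop := {
  if_killing_frame : frame_over A K xi;
  if_frame : frame_over A K X;
  if_commute : forall B D, is_bracket A K (xi B) (X D) (fun=> 0);
  if_bracket : forall B D,
    is_bracket A K (X B) (X D) (fun p => - \sum_P C P B D *: X P p) }.

(* Matrices are indexed as S^A_B = S A B, h_AB = h A B. *)
Definition preserves_sc (R : realType) (n : nat)
    (C : 'I_n -> 'I_n -> 'I_n -> R) (S : 'M[R]_n) : Prop :=
  forall A P Q,
    \sum_B S A B * C B P Q = \sum_K \sum_L C A K L * S K P * S L Q.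

Definition sc_generator (R : realType) (n : nat)
    (C : 'I_n -> 'I_n -> 'I_n -> R) (lam : 'M[R]_n) : Prop :=
  forall A P Q,
    \sum_B lam A B * C B P Q =
    \sum_B lam B P * C A B Q + \sum_B lam B Q * C A P B.

Definition equiv_frame_metric (R : realType) (n : nat) (h S : 'M[R]_n)
    : 'M[R]_n :=
  (invmx S)^T *m h *m invmx S.

(* F and G agree to first order in the r small parameters w *)
Definition first_order_eq (R : realType) (r : nat) (W : normedModType R)
    (F G : 'rV[R]_r -> W) : Prop :=
  (fun w => F w - G w) =o_ (0 : 'rV[R]_r) (fun w : 'rV[R]_r => w).

Definition affine_in (R : realType) (r : nat) (W : lmodType R)
    (F : 'rV[R]_r -> W) : Prop :=
  exists F0 : W, exists F1 : 'I_r -> W,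
    forall w, F w = F0 + \sum_a w 0 a *: F1 a.

(* [H] is the first-order expression of the frame metrics equivalent to [h]
   through matrices S(w), defined for w near 0, which preserve the structure
   constants and satisfy S(w) ~ 1 + w^a lam_(a). *)
Definition first_order_frame_metric (R : realType) (n r : nat)
    (C : 'I_n -> 'I_n -> 'I_n -> R) (h : 'M[R]_n) (lam : 'I_r -> 'M[R]_n)
    (H : 'rV[R]_r -> 'M[R]_n) : Prop :=
  (forall a, sc_generator C (lam a)) /\
  affine_in H /\
  exists S : 'rV[R]_r -> 'M[R]_n,
    [/\ \forall w \near (0 : 'rV[R]_r), S w \in unitmx /\ preserves_sc C (S w),
        first_order_eq S (fun w => 1%:M + \sum_a w 0 a *: lam a)
      & first_order_eq (fun w => equiv_frame_metric h (S w)) H].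

(* The members are the expressions H(t, w) in the outer variables t and the
   small parameters w^1, .., w^r. The row [Sig t a] holds the coefficients
   Sigma^B_a of the field Pi_a in the frame X. *)
Definition irreducible_frame_metrics (R : realType) (n r : nat)
    (M : topologicalType) (A : smooth_structure R n M) (T : Type) (K : set M)
    (C : 'I_n -> 'I_n -> 'I_n -> R) (X : 'I_n -> vfield R n M)
    (sigma : 'I_n -> cofield R n M) (h : T -> 'M[R]_n)
    : set (T -> 'rV[R]_r -> 'M[R]_n) :=
  [set H | exists (Sig : T -> 'M[R]_(r, n)) (lam : T -> 'I_r -> 'M[R]_n),
     forall t,
       (forall a B,
          is_lie_cofield A K (fun p => \sum_D Sig t a D *: X D p) (sigma B)
            (fun p => \sum_D lam t a B D *: sigma D p)) /\
       first_order_frame_metric C (h t) (lam t) (H t)].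

(* Main.v *)
Require Import Defs.
From HB Require Import structures.
From mathcomp Require Import all_boot all_order all_algebra.
From mathcomp Require Import all_classical all_reals all_analysis.
From mathcomp Require Import ring.

Set Implicit Arguments.
Unset Strict Implicit.
Unset Printing Implicit Defensive.

Import Order.TTheory GRing.Theory Num.Theory.
Import numFieldNormedType.Exports.

Local Open Scope classical_set_scope.
Local Open Scope ring_scope.

(** Write a generator field as [Pi = Sig^D X_D] with constant [Sig^D]. Pairing
    [L_Pi sigma^B] with [X_E] leaves only [- sigma^B([Pi, X_E])], which is
    [Sig^D C^B_DE] because [[X_D, X_E] = - C^M_DE X_M]. So a generator induced
    by a coordinate transformation is exactly an inner derivation of the
    structure constants, [lam^B_E = Sig^D C^B_DE] ([lie_coframe_lincomb]); that
    this is a derivation is the Jacobi identity, inherited from the commutators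
    of the frame fields ([ad_coef_sc_generator]).

    On the matrix side, [h = S^T ht S] for every frame metric [ht] equivalent to
    [h] through [S]. Expanding this product with [S ~ 1 + w lam] and comparing
    coefficients forces the first-order expression of [ht] to be
    [h - (w lam)^T h - h (w lam)]. Conversely each such expression is attained:
    the exponential of a derivation is an automorphism
    ([mxexp_sc_generator]), so that [S(w) = exp (w lam)] is a family of matrices
    preserving the structure constants with the prescribed first order
    ([first_order_frame_metricP]).

    Inserting [lam^B_E = Sig^D C^B_DE] gives the announced family, with
    [eps^N = - w^a Sig_a^N]; the sign is immaterial since [Sig] is arbitrary. *)

(** * The norm of a matrix *)

Section MatrixNorm.
Variable R : realType.

Lemma mx_norm_leP m n (A : 'M[R]_(m, n)) a : 0 <= a ->
  (`|A| <= a) <-> (forall i j, `|A i j| <= a).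
Proof.
move=> a0; rewrite [`|A|]mx_normrE; split=> [le_a i j|le_a].
  apply: le_trans le_a.
  exact: (le_bigmax _ (fun ij : 'I_m * 'I_n => `|A ij.1 ij.2|) (i, j)).
by apply: bigmax_le => // -[i j] _ /=.
Qed.

Lemma entry_le_norm m n (A : 'M[R]_(m, n)) i j : `|A i j| <= `|A|.
Proof. by have /mx_norm_leP := lexx `|A|; apply. Qed.

(** The norm is the largest absolute value of an entry, which is
    submultiplicative only up to the inner dimension. *)
Lemma ler_norm_mulmx m n p (A : 'M[R]_(m, n)) (B : 'M[R]_(n, p)) :
  `|A *m B| <= n%:R * (`|A| * `|B|).
Proof.
apply/mx_norm_leP => [|i j]; first by rewrite !mulr_ge0.
rewrite mxE (le_trans (ler_norm_sum _ _ _))//.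
rewrite -[n in n%:R * _]card_ord -sum1_card natr_sum mulr_suml ler_sum//= => l _.
by rewrite mul1r normrM ler_pM ?entry_le_norm.
Qed.

Lemma norm_trmx m n (A : 'M[R]_(m, n)) : `|A^T| = `|A|.
Proof.
apply/eqP; rewrite eq_le; apply/andP; split; apply/mx_norm_leP => // i j.
  by rewrite mxE entry_le_norm.
by have := entry_le_norm A^T j i; rewrite mxE.
Qed.

End MatrixNorm.

(** * Calculus of finite sums and products *)

Lemma is_derive_bigsum (R : realType) (V : normedModType R) n
    (f : 'I_n -> V -> R) (x v : V) (df : 'I_n -> R) :
  (forall i, is_derive x v (f i) (df i)) ->
  is_derive x v (fun y => \sum_i f i y) (\sum_i df i).
Proof. by move=> h; rewrite -fct_sumE; apply: is_derive_sum. Qed.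

Lemma is_derive_mul (R : realType) (V : normedModType R) (f g : V -> R)
    (x v : V) (df dg : R) :
  is_derive x v f df -> is_derive x v g dg ->
  is_derive x v (fun y => f y * g y) (df * g x + f x * dg).
Proof.
move=> hf hg; apply: (is_derive_eq (is_deriveM hf hg)).
by rewrite addrC [g x *: _]mulrC.
Qed.

Lemma is_derive_mulmx (R : realType) (V : normedModType R) m n p
    (F : V -> 'M[R]_(m, n)) (G : V -> 'M[R]_(n, p)) (x v : V)
    (dF : 'M[R]_(m, n)) (dG : 'M[R]_(n, p)) :
  (forall i j, is_derive x v (fun y => F y i j) (dF i j)) ->
  (forall i j, is_derive x v (fun y => G y i j) (dG i j)) ->
  forall i j, is_derive x v (fun y => (F y *m G y) i j)
                            ((dF *m G x + F x *m dG) i j).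
Proof.
move=> hF hG i j.
have -> : (fun y => (F y *m G y) i j) = (fun y => \sum_k F y i k * G y k j).
  by apply/funext => y; rewrite mxE.
rewrite !mxE -big_split /=.
by apply: is_derive_bigsum => k; exact: is_derive_mul.
Qed.

(** * Derivations of structure constants *)

(** The derivation property paired with two vectors [a] and [b]: it is the
    product rule [A C(a, b) = C(A a, b) + C(a, A b)]. *)
Lemma sc_generator_sum (R : realType) n (C : 'I_n -> 'I_n -> 'I_n -> R) A (i : 'I_n)
   (a b : 'I_n -> R) : sc_generator C A ->
  \sum_D A i D * (\sum_K \sum_L C D K L * (a K * b L)) =
  \sum_K \sum_L C i K L *
      ((\sum_M A K M * a M) * b L + a K * \sum_M A L M * b M).
Proof.
move=> genA.
transitivity (\sum_K \sum_L (\sum_D A i D * C D K L) * (a K * b L)).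
  under eq_bigr do rewrite mulr_sumr; rewrite exchange_big /=.
  apply: eq_bigr => K _; under eq_bigr do rewrite mulr_sumr.
  rewrite exchange_big /=; apply: eq_bigr => L _.
  by rewrite mulr_suml; apply: eq_bigr => D _; rewrite mulrA.
under eq_bigr do under eq_bigr do rewrite genA mulrDl !mulr_suml.
under [RHS]eq_bigr do under eq_bigr do
  rewrite mulrDr mulr_suml !mulr_sumr.
under eq_bigr do rewrite big_split /=; rewrite big_split /=.
under [RHS]eq_bigr do rewrite big_split /=; rewrite big_split /=.
congr (_ + _).
  under eq_bigr do rewrite exchange_big /=.
  rewrite exchange_big /=; apply: eq_bigr => K _.
  rewrite exchange_big /=; apply: eq_bigr => L _; apply: eq_bigr => M _.
  by rewrite -!mulrA mulrCA.
apply: eq_bigr => K _; rewrite exchange_big /=; apply: eq_bigr => L _.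
apply: eq_bigr => M _.
by rewrite -!mulrA mulrCA; congr (_ * _); rewrite mulrCA.
Qed.

(** * The exponential of a matrix *)

Section MatrixExponential.
Variables (R : realType) (n : nat).
Implicit Types (A B : 'M[R]_n) (s x a : R).

Definition mxexp A : 'M[R]_n :=
  \matrix_(i, j) limn (series (fun k => (A ^+ k) i j / k`!%:R)).

Lemma mxpowZ s A k : (s *: A) ^+ k = s ^+ k *: A ^+ k.
Proof.
elim: k => [|k IH]; first by rewrite !expr0 scale1r.
by rewrite exprS IH -mulmxE -scalemxAl -scalemxAr scalerA mulmxE -!exprS.
Qed.

Lemma mxpow_entry_le A a i j k :
  (forall i j, `|A i j| <= a) -> `|(A ^+ k) i j| <= (n%:R * a) ^+ k.
Proof.
move=> leA; have a0 : 0 <= a by rewrite (le_trans _ (leA i j)).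
elim: k i j => [|k IH] i j.
  by rewrite expr0 mxE expr0; case: (i == j); rewrite ?normr1 ?normr0.
rewrite exprS mxE (le_trans (ler_norm_sum _ _ _))// exprS -mulrA.
rewrite -[n in n%:R * _]card_ord -sum1_card natr_sum mulr_suml ler_sum//= => l _.
by rewrite mul1r normrM ler_pM.
Qed.

Lemma mxexp_term_le A a i j k : (forall i j, `|A i j| <= a) ->
  `|(A ^+ k) i j / k`!%:R| <= exp_coeff (n%:R * a) k.
Proof.
move=> leA; rewrite normrM normfV [ `|_`!%:R| ]ger0_norm//.
by rewrite ler_pM2r ?invr_gt0 ?ltr0n ?fact_gt0// mxpow_entry_le.
Qed.

Lemma cvg_mxexp A i j : cvgn (series (fun k => (A ^+ k) i j / k`!%:R)).
Proof.
apply: normed_cvg.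
apply: (@series_le_cvg _ _ (exp_coeff (n%:R * `|A|))) => [k|k|k|].
- exact: normr_ge0.
- by apply: exp_coeff_ge0; rewrite mulr_ge0.
- by apply: mxexp_term_le => *; exact: entry_le_norm.
- exact: is_cvg_series_exp_coeff.
Qed.

Lemma mxexp_scaleE A s i j :
  mxexp (s *: A) i j = limn (pseries (fun k => (A ^+ k) i j / k`!%:R) s).
Proof.
rewrite mxE /pseries; congr (limn (series _)); apply/funext => k.
by rewrite mxpowZ mxE -mulrA mulrC.
Qed.

Lemma cvg_mulmx_mxexp B A i j :
  series (fun k => (B *m A ^+ k) i j / k`!%:R) @ \oo --> (B *m mxexp A) i j.
Proof.
have -> : series (fun k => (B *m A ^+ k) i j / k`!%:R) = (fun N => \sum_l B i l *
    series (fun k => (A ^+ k) l j / k`!%:R) N).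
  apply/funext => N; rewrite /series /=.
  under [RHS]eq_bigr do rewrite mulr_sumr.
  rewrite exchange_big /=; apply: eq_bigr => k _.
  by rewrite mxE mulr_suml; apply: eq_bigr => l _; rewrite mulrA.
rewrite mxE; apply: cvg_big => [|l _]; first exact: add_continuous.
by apply: cvgMr; rewrite mxE; exact: cvg_mxexp.
Qed.

Lemma cvg_mxexp_mulmx B A i j :
  series (fun k => (A ^+ k *m B) i j / k`!%:R) @ \oo --> (mxexp A *m B) i j.
Proof.
have -> : series (fun k => (A ^+ k *m B) i j / k`!%:R) = (fun N => \sum_l
    series (fun k => (A ^+ k) i l / k`!%:R) N * B l j).
  apply/funext => N; rewrite /series /=.
  under [RHS]eq_bigr do rewrite mulr_suml.
  rewrite exchange_big /=; apply: eq_bigr => k _.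
  by rewrite mxE mulr_suml; apply: eq_bigr => l _; rewrite mulrAC.
rewrite mxE; apply: cvg_big => [|l _]; first exact: add_continuous.
by apply: cvgMl; rewrite mxE; exact: cvg_mxexp.
Qed.

Lemma mxexp_comm B A : B *m A = A *m B -> B *m mxexp A = mxexp A *m B.
Proof.
move=> BA; apply/matrixP => i j.
have <- := cvg_lim _ (@cvg_mxexp_mulmx B A i j) => //.
have <- := cvg_lim _ (@cvg_mulmx_mxexp B A i j) => //.
congr (limn (series _)); apply/funext => k; congr (fun_of_matrix _ i j / _).
by have /commrX -/(_ k) := (BA : GRing.comm B A).
Qed.

(** Leaving the factor [B] free makes this family of coefficients stable under
    formal differentiation of power series ([pseries_diffs_coef]), so that one
    convergence statement covers the first and second derivatives. *)
Let coef B A i j k := (B *m A ^+ k) i j / k`!%:R.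

Lemma cvg_coef_sum B A i j s :
  pseries (coef B A i j) s @ \oo --> (B *m mxexp (s *: A)) i j.
Proof.
have <- : series (fun k => (B *m (s *: A) ^+ k) i j / k`!%:R) =
          pseries (coef B A i j) s; last exact: cvg_mulmx_mxexp.
rewrite /pseries; congr series; apply/funext => k.
by rewrite /coef mxpowZ -scalemxAr mxE -mulrA mulrC.
Qed.

Lemma cvg_coef B A i j s : cvgn (pseries (coef B A i j) s).
Proof. by apply/cvg_ex; eexists; exact: cvg_coef_sum. Qed.

Lemma pseries_diffs_coef B A i j :
  pseries_diffs (coef B A i j) = coef (B *m A) A i j.
Proof.
apply/funext => k; rewrite /pseries_diffs /coef exprS mulmxA factS natrM invfM.
by rewrite mulrCA mulVKf// pnatr_eq0.
Qed.

Lemma is_derive_mxexp A s i j :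
  is_derive s (1 : R) (fun y => mxexp (y *: A) i j) ((A *m mxexp (s *: A)) i j).
Proof.
have -> : (fun y => mxexp (y *: A) i j) =
          (fun y => limn (pseries (coef 1%:M A i j) y)).
  apply/funext => y; rewrite mxexp_scaleE; congr (limn (pseries _ _)).
  by apply/funext => k; rewrite /coef mul1mx.
have -> : (A *m mxexp (s *: A)) i j =
          limn (pseries (pseries_diffs (coef 1%:M A i j)) s).
  by rewrite pseries_diffs_coef mul1mx; apply/esym/cvg_lim/cvg_coef_sum.
(* the power series converge everywhere: any radius larger than [`|s|] will do *)
apply: (@pseries_snd_diffs _ _ (`|s| + 1));
  rewrite ?pseries_diffs_coef; try exact: cvg_coef.
by rewrite [ltRHS]ger0_norm ?addr_ge0// ltrDl.
Qed.

Lemma mxexp0 : mxexp 0 = 1%:M.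
Proof.
apply/matrixP => i j; rewrite mxE; apply: lim_near_cst => //.
near=> N; have N0 : (0 < N)%N by near: N; exists 1%N.
rewrite -(prednK N0) /series /= big_nat_recl//= expr0 fact0 divr1.
by rewrite big1 ?addr0// => k _; rewrite expr0n mxE mul0r.
Unshelve. all: by end_near. Qed.

(** Uniqueness for [y' = A y]: [exp (- u A) y(u)] has zero derivative. Both the
    inversion formula and the automorphism property of the exponential are
    instances of it. *)
Lemma linear_ode_sol p A (y : R -> 'M[R]_(n, p)) s :
  (forall t i j, is_derive t (1 : R) (fun u => y u i j) ((A *m y t) i j)) ->
  y 0 = mxexp (- (s *: A)) *m y s.
Proof.
move=> dy; rewrite -[LHS]mul1mx -mxexp0; apply/matrixP => i j.
pose z u := (mxexp (u *: (- A)) *m y u) i j.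
suff : z 0 = z s by rewrite /z scale0r scalerN.
apply: is_derive_0_is_cst => t; apply: is_derive_eq.
  exact: (is_derive_mulmx (is_derive_mxexp (- A) t) (dy t)).
rewrite [X in X *m y t]mxexp_comm; last first.
  by rewrite -scalemxAl -scalemxAr.
by rewrite mulmxN mulNmx mulmxA addNr mxE.
Qed.

Lemma mxexpNK A : mxexp (- A) *m mxexp A = 1%:M.
Proof.
have := linear_ode_sol 1 (fun t i j => is_derive_mxexp A t i j).
by rewrite !scale1r scale0r mxexp0.
Qed.

Lemma mxexp_unit A : mxexp A \in unitmx.
Proof. by have /mulmx1_unit[] := mxexpNK A. Qed.

Lemma invmx_mxexp A : invmx (mxexp A) = mxexp (- A).
Proof. by rewrite -[RHS](mulmxK (mxexp_unit A)) mxexpNK mul1mx. Qed.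

(** For a derivation [A], the tensors [C(S(s) -, S(s) -)] with [S(s) = exp (s A)]
    solve [y' = A y] with initial value [C]; by uniqueness they are [S(s) C]. *)
Lemma mxexp_sc_generator (C : 'I_n -> 'I_n -> 'I_n -> R) A :
  sc_generator C A -> preserves_sc C (mxexp A).
Proof.
move=> genA B P Q; pose S s := mxexp (s *: A).
pose y s : 'cV[R]_n := \col_D \sum_K \sum_L C D K L * (S s K P * S s L Q).
have dS t i j : is_derive t (1 : R) (fun u => S u i j) ((A *m S t) i j).
  exact: is_derive_mxexp.
have dy t i j : is_derive t (1 : R) (fun u => y u i j) ((A *m y t) i j).
  have -> : (fun u => y u i j) =
      (fun u => \sum_K \sum_L C i K L * (S u K P * S u L Q)).
    by apply/funext => u; rewrite mxE.
  have -> : (A *m y t) i j = \sum_K \sum_L C i K L *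
      ((A *m S t) K P * S t L Q + S t K P * (A *m S t) L Q).
    rewrite mxE.
    under eq_bigr do rewrite mxE.
    rewrite (sc_generator_sum i (fun K => S t K P) (fun L => S t L Q) genA).
    by apply: eq_bigr => K _; apply: eq_bigr => L _; rewrite !mxE.
  apply: is_derive_bigsum => K; apply: is_derive_bigsum => L.
  have dSS := is_derive_mul (dS t K P) (dS t L Q).
  apply: (is_derive_eq (is_derive_mul (is_derive_cst (C i K L) t 1) dSS)).
  by rewrite mul0r add0r.
have /(congr1 (mulmx (mxexp A))) := linear_ode_sol 1 dy.
rewrite scale1r mulmxA (mulmx1C (mxexpNK A)) mul1mx => /matrixP/(_ B 0).
rewrite [RHS]mxE.
have S1 : S 1 = mxexp A by rewrite /S scale1r.
under [RHS]eq_bigr do under eq_bigr do rewrite S1 mulrA.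
move=> <-; rewrite mxE; apply: eq_bigr => D _; congr (_ * _); rewrite mxE.
have S0 : S 0 = 1%:M by rewrite /S scale0r mxexp0.
rewrite S0 (bigD1 P)//= [X in _ + X]big1 ?addr0; last first.
  move=> K KP; rewrite big1// => L _.
  by rewrite mxE (negPf KP) mul0r mulr0.
rewrite (bigD1 Q)//= [X in _ + X]big1 ?addr0; last first.
  by move=> L LQ; rewrite [X in _ * X]mulrC mxE (negPf LQ) mul0r mulr0.
by rewrite !mxE !eqxx !mulr1.
Qed.

(** The terms of order 0 and 1 cancel, and the remaining ones are dominated by
    those of the real exponential. *)
Lemma mxexp_expansion A a i j : (forall i j, `|A i j| <= a) ->
  `|(mxexp A - 1%:M - A) i j| <= expR (n%:R * a) - 1 - n%:R * a.
Proof.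
move=> leA; have a0 : 0 <= a by rewrite (le_trans _ (leA i j)).
set x := n%:R * a; pose f k := (A ^+ k) i j / k`!%:R.
have cf : `|series f N - (1%:M : 'M[R]_n) i j - A i j| @[N --> \oo] -->
    `|(mxexp A - 1%:M - A) i j|.
  rewrite !mxE; apply: cvg_norm; apply: cvgB; last exact: cvg_cst.
  by apply: cvgB; [exact: cvg_mxexp|exact: cvg_cst].
have ce : series (exp_coeff x) N - 1 - x @[N --> \oo] --> expR x - 1 - x.
  apply: cvgB; last exact: cvg_cst.
  by apply: cvgB; [exact: is_cvg_series_exp_coeff|exact: cvg_cst].
apply: (ler_cvg_to cf ce); near=> N.
have [N' ->] : exists N', N = N'.+2.
  by exists N.-2; rewrite -[LHS](@subnK 2) ?addn2 ?subn2//; near: N; exists 2%N.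
rewrite /series /= !big_nat_recl//= /f expr0 fact0 divr1 expr1 (factE 1) divr1.
rewrite /exp_coeff /= expr0 fact0 divr1 expr1 (factE 1) divr1.
rewrite mxE.
have cancel (u v w : R) : u + (v + w) - u - v = w.
  by rewrite (addrC u) addrK (addrC v) addrK.
rewrite !cancel (le_trans (ler_norm_sum _ _ _))// ler_sum// => k _.
exact: mxexp_term_le.
Unshelve. all: by end_near. Qed.

End MatrixExponential.

(** * First-order expansions in small parameters *)

Section FirstOrder.
Variables (R : realType) (r : nat).

Definition negligible_at0 (W : normedModType R) (F : 'rV[R]_r -> W) :=
  forall e : R, 0 < e -> \forall w \near (0 : 'rV[R]_r), `|F w| <= e * `|w|.

Definition bounded_at0 (W : normedModType R) (F : 'rV[R]_r -> W) :=
  exists c : R, \forall w \near (0 : 'rV[R]_r), `|F w| <= c.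

Definition linearly_bounded (W : normedModType R) (F : 'rV[R]_r -> W) :=
  exists2 c : R, 0 <= c & forall w, `|F w| <= c * `|w|.

Lemma first_order_eqP (W : normedModType R) (F G : 'rV[R]_r -> W) :
  first_order_eq F G <-> negligible_at0 (fun w => F w - G w).
Proof. by rewrite /first_order_eq; split => /eqoP. Qed.

Lemma near0_norm_le (e : R) : 0 < e -> \forall w \near (0 : 'rV[R]_r), `|w| <= e.
Proof. exact: nbhs0_le. Qed.

Lemma negligibleD (W : normedModType R) (F G : 'rV[R]_r -> W) :
  negligible_at0 F -> negligible_at0 G -> negligible_at0 (fun w => F w + G w).
Proof.
move=> sF sG e e0; near=> w; rewrite (splitr e) mulrDl.
rewrite (le_trans (ler_normD _ _))// lerD//; near: w.
  by apply: sF; rewrite divr_gt0.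
by apply: sG; rewrite divr_gt0.
Unshelve. all: by end_near. Qed.

Lemma negligible_bounded (W : normedModType R) (F : 'rV[R]_r -> W) :
  negligible_at0 F -> bounded_at0 F.
Proof.
move=> sF; exists 1; near=> w.
rewrite (@le_trans _ _ (1 * `|w|))//; first by near: w; exact: sF.
by rewrite mul1r; near: w; exact: near0_norm_le.
Unshelve. all: by end_near. Qed.

Lemma linearly_bounded_bounded (W : normedModType R) (F : 'rV[R]_r -> W) :
  linearly_bounded F -> bounded_at0 F.
Proof.
move=> [c c0 leF]; exists c; near=> w; rewrite (le_trans (leF w))//.
by rewrite ler_piMr//; near: w; exact: near0_norm_le.
Unshelve. all: by end_near. Qed.

Lemma bounded_cst (W : normedModType R) (a : W) : bounded_at0 (fun=> a).
Proof. by exists `|a|; near=> w. Unshelve. all: by end_near. Qed.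

Lemma boundedD (W : normedModType R) (F G : 'rV[R]_r -> W) :
  bounded_at0 F -> bounded_at0 G -> bounded_at0 (fun w => F w + G w).
Proof.
move=> [c sF] [d sG]; exists (c + d); near=> w.
by rewrite (le_trans (ler_normD _ _))// lerD//; near: w.
Unshelve. all: by end_near. Qed.

Lemma negligible_mulmxl m n p (F : 'rV[R]_r -> 'M[R]_(m, n))
    (G : 'rV[R]_r -> 'M[R]_(n, p)) :
  negligible_at0 F -> bounded_at0 G -> negligible_at0 (fun w => F w *m G w).
Proof.
move=> sF [c bG] e e0; pose k := n%:R * (`|c| + 1) + 1.
have k0 : 0 < k by rewrite ltr_wpDl// mulr_ge0// addr_ge0.
near=> w; rewrite (le_trans (ler_norm_mulmx _ _))//.
have Fw : `|F w| <= e / k * `|w| by near: w; apply: sF; rewrite divr_gt0.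
have Gw : `|G w| <= `|c| + 1.
  rewrite (@le_trans _ _ c)//; first by near: w.
  by rewrite ler_wpDr// ler_norm.
rewrite (@le_trans _ _ (n%:R * (e / k * `|w| * (`|c| + 1))))//.
  by rewrite ler_wpM2l// ler_pM.
have -> : n%:R * (e / k * `|w| * (`|c| + 1)) =
    (n%:R * (`|c| + 1) / k) * (e * `|w|) by ring.
by rewrite ler_piMl ?mulr_ge0 ?(ltW e0)// ler_pdivrMr// mul1r lerDl.
Unshelve. all: by end_near. Qed.

Lemma negligible_trmx m n (F : 'rV[R]_r -> 'M[R]_(m, n)) :
  negligible_at0 F -> negligible_at0 (fun w => (F w)^T).
Proof.
by move=> sF e e0; near=> w; rewrite norm_trmx; near: w; exact: sF.
Unshelve. all: by end_near. Qed.

Lemma bounded_trmx m n (F : 'rV[R]_r -> 'M[R]_(m, n)) :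
  bounded_at0 F -> bounded_at0 (fun w => (F w)^T).
Proof.
by move=> [c sF]; exists c; near=> w; rewrite norm_trmx; near: w.
Unshelve. all: by end_near. Qed.

Lemma negligible_mulmxr m n p (F : 'rV[R]_r -> 'M[R]_(m, n))
    (G : 'rV[R]_r -> 'M[R]_(n, p)) :
  bounded_at0 F -> negligible_at0 G -> negligible_at0 (fun w => F w *m G w).
Proof.
move=> /bounded_trmx bF /negligible_trmx sG.
have := negligible_trmx (negligible_mulmxl sG bF).
by under eq_fun do rewrite trmx_mul !trmxK.
Qed.

Lemma negligible_mulmx_linear m n p (F : 'rV[R]_r -> 'M[R]_(m, n))
    (G : 'rV[R]_r -> 'M[R]_(n, p)) :
  linearly_bounded F -> linearly_bounded G ->
  negligible_at0 (fun w => F w *m G w).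
Proof.
move=> [c c0 lF] [d d0 lG] e e0; pose k := n%:R * (c * d) + 1.
have k0 : 0 < k by rewrite ltr_wpDl// !mulr_ge0.
near=> w; have we : `|w| <= e / k.
  by near: w; apply: near0_norm_le; rewrite divr_gt0.
rewrite (le_trans (ler_norm_mulmx _ _))//.
rewrite (@le_trans _ _ (n%:R * ((c * `|w|) * (d * `|w|))))//.
  by rewrite ler_wpM2l// ler_pM.
have -> : n%:R * (c * `|w| * (d * `|w|)) = (n%:R * (c * d) * `|w|) * `|w| by ring.
rewrite ler_wpM2r// (@le_trans _ _ (n%:R * (c * d) * (e / k)))//.
  by rewrite ler_wpM2l// !mulr_ge0.
by rewrite mulrCA ler_piMr ?(ltW e0)// ler_pdivrMr// mul1r lerDl.
Unshelve. all: by end_near. Qed.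

(** [F1] stands for the linear part; only the bound [`|F1 w| <= c * `|w|] is
    imposed, which keeps the product rule short, and homogeneity is added where
    the coefficients must be determined ([expansion_unique]). *)
Definition expansion m n (F : 'rV[R]_r -> 'M[R]_(m, n)) F0 F1 :=
  linearly_bounded F1 /\ negligible_at0 (fun w => F w - (F0 + F1 w)).

Lemma expansion_bounded m n (F : 'rV[R]_r -> 'M[R]_(m, n)) F0 F1 :
  expansion F F0 F1 -> bounded_at0 F.
Proof.
move=> [lF1 /negligible_bounded bF].
have := boundedD bF (boundedD (bounded_cst F0) (linearly_bounded_bounded lF1)).
by under eq_fun do rewrite subrK.
Qed.

Lemma expansion_cst m n (h : 'M[R]_(m, n)) : expansion (fun=> h) h (fun=> 0).
Proof.
split; first by exists 0 => // w; rewrite normr0 mul0r.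
by move=> e e0; near=> w; rewrite addr0 subrr normr0 mulr_ge0// ltW.
Unshelve. all: by end_near. Qed.

Lemma expansion_trmx m n (F : 'rV[R]_r -> 'M[R]_(m, n)) F0 F1 :
  expansion F F0 F1 -> expansion (fun w => (F w)^T) F0^T (fun w => (F1 w)^T).
Proof.
move=> [[c c0 lF1] sF]; split; first by exists c => // w; rewrite norm_trmx.
by move=> e e0; near=> w; rewrite -!linearD/= -linearB norm_trmx; near: w; exact: sF.
Unshelve. all: by end_near. Qed.

Lemma linearly_boundedD (W : normedModType R) (F G : 'rV[R]_r -> W) :
  linearly_bounded F -> linearly_bounded G ->
  linearly_bounded (fun w => F w + G w).
Proof.
move=> [c c0 lF] [d d0 lG]; exists (c + d); first exact: addr_ge0.
by move=> w; rewrite (le_trans (ler_normD _ _))// mulrDl lerD.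
Qed.

Lemma linearly_bounded_mulmxl m n p (A : 'M[R]_(m, n))
    (F : 'rV[R]_r -> 'M[R]_(n, p)) :
  linearly_bounded F -> linearly_bounded (fun w => A *m F w).
Proof.
move=> [c c0 lF]; exists (n%:R * (`|A| * c)); first by rewrite !mulr_ge0.
move=> w; rewrite (le_trans (ler_norm_mulmx _ _))// -!mulrA.
by rewrite !ler_wpM2l.
Qed.

Lemma linearly_bounded_mulmxr m n p (F : 'rV[R]_r -> 'M[R]_(m, n))
    (A : 'M[R]_(n, p)) :
  linearly_bounded F -> linearly_bounded (fun w => F w *m A).
Proof.
move=> [c c0 lF]; exists (n%:R * (`|A| * c)); first by rewrite !mulr_ge0.
move=> w; rewrite (le_trans (ler_norm_mulmx _ _))// [`|F w| * _]mulrC -!mulrA.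
by rewrite !ler_wpM2l.
Qed.

(** [F G - F0 G0 - F1 G0 - F0 G1] equals
    [(F - F0 - F1) G + (F0 + F1) (G - G0 - G1) + F1 G1]. *)
Lemma expansion_mulmx m n p (F : 'rV[R]_r -> 'M[R]_(m, n))
    (G : 'rV[R]_r -> 'M[R]_(n, p)) F0 F1 G0 G1 :
  expansion F F0 F1 -> expansion G G0 G1 ->
  expansion (fun w => F w *m G w) (F0 *m G0)
            (fun w => F1 w *m G0 + F0 *m G1 w).
Proof.
move=> xF xG; have bG := expansion_bounded xG.
case: xF xG => lF1 sF [lG1 sG]; split.
  apply: linearly_boundedD; first exact: linearly_bounded_mulmxr.
  exact: linearly_bounded_mulmxl.
have bF := boundedD (bounded_cst F0) (linearly_bounded_bounded lF1).
have := negligibleD (negligible_mulmxl sF bG)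
  (negligibleD (negligible_mulmxr bF sG) (negligible_mulmx_linear lF1 lG1)).
congr negligible_at0; apply/funext => w.
rewrite mulmxBl mulmxBr addrA subrKA !mulmxDl !mulmxDr -!addrA; congr (_ + _).
rewrite !opprD -!addrA; congr (_ + _).
by rewrite addrCA; congr (_ + _); rewrite addNr addr0.
Qed.

Lemma near_eq_expansion m n (F G : 'rV[R]_r -> 'M[R]_(m, n)) F0 F1 :
  (\forall w \near (0 : 'rV[R]_r), F w = G w) ->
  expansion F F0 F1 -> expansion G F0 F1.
Proof.
move=> FG [lF sF]; split=> // e e0; near=> w.
by rewrite -(_ : F w = G w); near: w; [exact: sF|].
Unshelve. all: by end_near. Qed.

(** Rescaling [w] into the ball where the bound holds multiplies both sides of it
    by the same factor, hence the bound holds everywhere, for each [e]. *)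
Lemma negligible_homogeneous (W : normedModType R) (L : 'rV[R]_r -> W) :
  (forall a w, L (a *: w) = a *: L w) -> negligible_at0 L -> L =1 (fun=> 0).
Proof.
move=> LZ sL w; apply/eqP; rewrite -normr_eq0; apply: contraT => Lw_neq0.
have Lw_gt0 : 0 < `|L w| by rewrite lt_neqAle eq_sym Lw_neq0 /=.
have w1_gt0 : 0 < `|w| + 1 by rewrite ltr_wpDl.
(* with this [e] the bound would read [`|L w| <= `|L w| * (`|w| / (`|w| + 1))] *)
have /sL/nbhs_ballP[d /= d0 sub] : 0 < `|L w| / (`|w| + 1) by rewrite divr_gt0.
pose t := d / (`|w| + 1); have t_gt0 : 0 < t by rewrite divr_gt0.
have : `|L (t *: w)| <= `|L w| / (`|w| + 1) * `|t *: w|.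
  apply: sub; rewrite -ball_normE /ball_ /= sub0r normrN normrZ gtr0_norm//.
  by rewrite /t mulrAC ltr_pdivrMr// ltr_pM2l// ltrDl.
rewrite LZ !normrZ mulrCA ler_pM2l ?gtr0_norm// -mulrA ler_pMr//.
by rewrite mulrC ler_pdivlMr// mul1r leNgt ltrDl ltr01.
Qed.

Lemma expansion_unique m n (F : 'rV[R]_r -> 'M[R]_(m, n)) F0 F1 G0 G1 :
  (forall a w, F1 (a *: w) = a *: F1 w) -> (forall a w, G1 (a *: w) = a *: G1 w) ->
  expansion F F0 F1 -> expansion F G0 G1 -> F0 = G0 /\ F1 =1 G1.
Proof.
move=> F1Z G1Z [_ sF] [_ sG].
have sN : negligible_at0 (fun w => - (F w - (F0 + F1 w))).
  by move=> e e0; near=> w; rewrite normrN; near: w; exact: sF.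
have s : negligible_at0 (fun w => (F0 - G0) + (F1 w - G1 w)).
  have := negligibleD sN sG; congr negligible_at0; apply/funext => w.
  by rewrite opprB addrA subrK opprD addrACA.
have F0G0 : F0 = G0.
  have /nbhs_singleton := s _ ltr01.
  rewrite -[0 : 'rV_r](scale0r 0) F1Z G1Z !scale0r subr0 addr0 normr0 mulr0.
  by rewrite normr_le0 subr_eq0 => /eqP.
split=> // w; apply/eqP; rewrite -subr_eq0; apply/eqP.
apply: (@negligible_homogeneous _ (fun w => F1 w - G1 w)).
  by move=> a v; rewrite F1Z G1Z scalerBr.
by move: s; rewrite F0G0 subrr; under eq_fun do rewrite add0r.
Unshelve. all: by end_near. Qed.

(** From [expR x <= 1 / (1 - x)] and
    [(1 + x + 2 x^2) (1 - x) = 1 + x^2 (1 - 2 x)]. *)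
Lemma expR_quadratic (x : R) : 0 <= x -> x <= 1 / 2 ->
  expR x - 1 - x <= 2 * x ^+ 2.
Proof.
move=> x0 x2; rewrite lerBlDr lerBlDr.
have x1 : 0 < 1 - x by rewrite subr_gt0 (le_lt_trans x2)// ltr_pdivrMr// mul1r ltr1n.
rewrite -(ler_pM2r x1) (@le_trans _ _ 1)//.
  rewrite (le_trans (ler_wpM2l (expR_ge0 x) (expR_ge1Dx (- x))))//.
  by rewrite -expRD subrr expR0.
rewrite -subr_ge0 (_ : _ - 1 = x ^+ 2 * (1 - 2 * x)); last by ring.
by rewrite mulr_ge0 ?exprn_ge0// subr_ge0 mulrC -ler_pdivlMr.
Qed.

(** The remainder is at most [2 (n c)^2 `|w|^2] as soon as [n c `|w| <= 1/2];
    the two radii below make this [<= e * `|w|]. *)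
Lemma expansion_mxexp n (L : 'rV[R]_r -> 'M[R]_n) :
  linearly_bounded L -> expansion (fun w => mxexp (L w)) 1%:M L.
Proof.
move=> lL; split=> // e e0; have [c c0 leL] := lL.
pose k := 2 * (n%:R * c) ^+ 2 + 1.
have k0 : 0 < k by rewrite ltr_wpDl// mulr_ge0// exprn_ge0// mulr_ge0.
pose k' := n%:R * c * 2 + 1.
have k'0 : 0 < k' by rewrite ltr_wpDl// !mulr_ge0.
near=> w.
have w1 : `|w| <= e / k by near: w; apply: near0_norm_le; rewrite divr_gt0.
have w2 : `|w| <= 1 / k' by near: w; apply: near0_norm_le; rewrite divr_gt0.
apply/mx_norm_leP => [|i j]; first by rewrite mulr_ge0// ltW.
have le_a (i' j' : 'I_n) : `|L w i' j'| <= c * `|w|.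
  exact: le_trans (entry_le_norm _ _ _) (leL w).
rewrite opprD addrA (le_trans (mxexp_expansion i j le_a))//.
rewrite (le_trans (expR_quadratic _ _)) ?mulr_ge0//.
  rewrite mulrA (@le_trans _ _ (n%:R * c * (1 / k')))//.
    by rewrite ler_wpM2l// mulr_ge0.
  rewrite mulrA mulr1 ler_pdivrMr// mulrAC mul1r ler_pdivlMr//.
  by rewrite lerDl.
rewrite mulrA exprMn mulrA [_ ^+ 2 as X in _ * X]expr2 mulrA ler_wpM2r//.
rewrite (le_trans (ler_wpM2l _ w1)) ?mulr_ge0 ?exprn_ge0 ?mulr_ge0//.
by rewrite mulrCA ler_piMr ?(ltW e0)// ler_pdivrMr// mul1r lerDl.
Unshelve. all: by end_near. Qed.

Definition lin_comb n (lam : 'I_r -> 'M[R]_n) (w : 'rV[R]_r) :=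
  \sum_a w 0 a *: lam a.

Lemma lin_combZ n (lam : 'I_r -> 'M[R]_n) b w :
  lin_comb lam (b *: w) = b *: lin_comb lam w.
Proof. by rewrite scaler_sumr; apply: eq_bigr => a _; rewrite mxE scalerA. Qed.

Lemma lin_comb_bounded n (lam : 'I_r -> 'M[R]_n) :
  linearly_bounded (lin_comb lam).
Proof.
exists (\sum_a `|lam a|); first exact: sumr_ge0.
move=> w; rewrite (le_trans (ler_norm_sum _ _ _))// mulr_suml ler_sum// => a _.
by rewrite normrZ mulrC ler_wpM2l// entry_le_norm.
Qed.

Lemma sc_generator_lin_comb n (C : 'I_n -> 'I_n -> 'I_n -> R)
    (lam : 'I_r -> 'M[R]_n) w :
  (forall a, sc_generator C (lam a)) -> sc_generator C (lin_comb lam w).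
Proof.
move=> gen B P Q.
have lamE D E : lin_comb lam w D E = \sum_a w 0 a * lam a D E.
  by rewrite summxE; apply: eq_bigr => a _; rewrite mxE.
have sumE (f g : 'I_n -> 'I_n) (c : 'I_n -> R) :
    \sum_D lin_comb lam w (f D) (g D) * c D =
    \sum_a w 0 a * \sum_D lam a (f D) (g D) * c D.
  under eq_bigr do rewrite lamE mulr_suml.
  rewrite exchange_big /=; apply: eq_bigr => a _; rewrite mulr_sumr.
  by apply: eq_bigr => D _; rewrite mulrA.
rewrite (sumE (fun=> B) id) (sumE id (fun=> P)) (sumE id (fun=> Q)) -big_split.
by apply: eq_bigr => a _; rewrite gen mulrDr.
Qed.

(** From left to right no inverse is expanded: [h = S^T ht S] near 0, the right
    side is expanded as a product, and the constant function [h] has no linear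
    part. From right to left the witness is [S = exp L], whose inverse
    [exp (- L)] has an explicit expansion as well. *)
Lemma first_order_frame_metricP n (C : 'I_n -> 'I_n -> 'I_n -> R) (h : 'M[R]_n)
    (lam : 'I_r -> 'M[R]_n) (H : 'rV[R]_r -> 'M[R]_n) :
  first_order_frame_metric C h lam H <->
  (forall a, sc_generator C (lam a)) /\
  (forall w, H w = h - (lin_comb lam w)^T *m h - h *m lin_comb lam w).
Proof.
pose L := lin_comb lam; have lL : linearly_bounded L := lin_comb_bounded lam.
split=> [[gen [[H0 [H1 affH]] [S [S_ok /first_order_eqP S_exp
    /first_order_eqP H_exp]]]]|[gen defH]]; split=> //.
- have xS : expansion S 1%:M L by [].
  have xH : expansion (fun w => equiv_frame_metric h (S w)) H0 (lin_comb H1).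
    split; first exact: lin_comb_bounded.
    by move: H_exp; under eq_fun do rewrite affH.
  have := expansion_mulmx (expansion_mulmx (expansion_trmx xS) xH) xS.
  move=> /(@near_eq_expansion _ _ _ (fun=> h)) X.
  have {}/X X : \forall w \near (0 : 'rV[R]_r),
      (S w)^T *m equiv_frame_metric h (S w) *m S w = h.
    near=> w; have [Su _] : S w \in unitmx /\ preserves_sc C (S w) by near: w.
    rewrite /equiv_frame_metric !mulmxA -trmx_mul mulVmx// trmx1 mul1mx.
    by rewrite mulmxKV.
  have [] := expansion_unique _ _ (expansion_cst h) X.
  + by move=> *; rewrite scaler0.
  + move=> a w; rewrite /L !lin_combZ linearZ/= trmx1.
    by rewrite !(mul1mx, mulmx1) -scalemxAl -scalemxAr -!scalerDr.
  rewrite trmx1 mul1mx mulmx1 => hH0; rewrite -hH0 => X1 w; rewrite affH -hH0.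
  have /esym := X1 w; rewrite !(mul1mx, mulmx1) => /eqP.
  rewrite addrAC addr_eq0 => /eqP E.
  rewrite -[\sum_a _]/(lin_comb H1 w) -[lin_comb H1 w]opprK -E opprD.
  by rewrite addrA.
- split.
    exists h, (fun a => - (lam a)^T *m h - h *m lam a) => w.
    rewrite defH -addrA; congr (_ + _).
    rewrite /lin_comb linear_sum /= mulmx_suml mulmx_sumr -!sumrN -big_split /=.
    apply: eq_bigr => a _; rewrite linearZ /= -scalemxAl -scalemxAr.
    by rewrite scalerBr mulNmx scalerN.
  exists (fun w => mxexp (L w)); split.
  + near=> w; split; first exact: mxexp_unit.
    exact/mxexp_sc_generator/sc_generator_lin_comb.
  + by apply/first_order_eqP; case: (expansion_mxexp lL).
  + apply/first_order_eqP.
    have lNL : linearly_bounded (fun w => - L w).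
      by have [c c0 leL] := lL; exists c => // w; rewrite normrN.
    have xE := expansion_mxexp lNL.
    have [_] := expansion_mulmx (expansion_mulmx (expansion_trmx xE)
      (expansion_cst h)) xE.
    congr negligible_at0; apply/funext => w.
    rewrite /equiv_frame_metric invmx_mxexp; congr (_ - _).
    rewrite /= defH trmx1 !(mul1mx, mulmx1) addr0 -addrA; congr (_ + _).
    by rewrite linearN mulNmx mulmxN.
Unshelve. all: by end_near. Qed.
End FirstOrder.

(** * Functions of class C^k *)

Section ClassCk.
Variables (R : realType) (V : normedModType R).
Implicit Types (U : set V) (k : nat).

Lemma near_eq_differentiable (W : normedModType R) (f g : V -> W) (x : V) :
  (\forall y \near x, f y = g y) -> differentiable f x -> differentiable g x.
Proof.
move=> fg df; have [cdf Ef] := (diff_locallyP _ _).1 df.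
have Eg : g \o shift x = cst (g x) + 'd f x +o_ (0 : V) id.
  apply/eqaddoP => e e0; move/eqaddoP : Ef => /(_ _ e0) Ef.
  near=> h.
  have <- : (f \o shift x - (cst (f x) + 'd f x)) h =
            (g \o shift x - (cst (g x) + 'd f x)) h.
    rewrite /= (nbhs_singleton fg); congr (_ - _); rewrite /=.
    by near: h; move: fg; rewrite (near_shift 0 x) subr0.
  by near: h.
by apply/diff_locallyP; rewrite (diff_unique cdf Eg).
Unshelve. all: by end_near. Qed.

Lemma open_near U (f g : V -> R) x : open U -> (forall y, U y -> f y = g y) ->
  U x -> \forall y \near x, f y = g y.
Proof.
by move=> oU fg Ux; near=> y; apply: fg; near: y; apply: open_nbhs_nbhs; split.
Unshelve. all: by end_near. Qed.

(** On an open set the class C^k depends only on the values there, although the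
    iterated derivatives are defined from the values on the whole space. *)
Lemma Ck_ext U k (f g : V -> R) : open U -> (forall x, U x -> f x = g x) ->
  Ck k U f -> Ck k U g.
Proof.
elim: k f g => [|k IH] f g oU fg /=.
  move=> cf x Ux; have fgx := open_near oU fg Ux.
  rewrite /prop_for /continuous_at -(nbhs_singleton fgx).
  apply: cvg_trans (cf x Ux); apply: near_eq_cvg.
  by near=> y; near: y; exact: fgx.
move=> [df Df]; split.
  by move=> x Ux; apply: near_eq_differentiable (df x Ux); exact: open_near Ux.
move=> v; apply: (IH (fun x => 'D_v f x)) (Df v) => // x Ux.
by apply: near_eq_derive; exact: open_near Ux.
Unshelve. all: by end_near. Qed.

Lemma Ck_sub (W : normedModType R) U U' k (f : V -> W) :
  U' `<=` U -> Ck k U f -> Ck k U' f.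
Proof.
elim: k f => [|k IH] f sU /=; first by move=> cf x /sU; exact: cf.
by move=> [df Df]; split=> [x /sU|v]; [exact: df|exact: IH].
Qed.

Lemma Ck_cst U k (a : R) : open U -> Ck k U (fun=> a).
Proof.
elim: k a => [|k IH] a oU /=; first by move=> x _; exact: cst_continuous.
split=> [x _|v]; first exact: differentiable_cst.
by apply: (Ck_ext oU _ (IH 0 oU)) => x _; rewrite derive_cst.
Qed.

Lemma CkZD U k (a : R) (f g : V -> R) : open U -> Ck k U f -> Ck k U g ->
  Ck k U (fun x => a * f x + g x).
Proof.
elim: k f g => [|k IH] f g oU /=.
  move=> cf cg x Ux; apply: cvgD; last exact: cg.
  by apply: cvgMr; exact: cf.
move=> [df Df] [dg Dg]; split=> [x Ux|v].
  by apply: differentiableD (dg x Ux); apply: differentiableZ; exact: df.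
apply: (Ck_ext oU _ (IH _ _ oU (Df v) (Dg v))) => x Ux.
have dfv : derivable f x v by apply: diff_derivable; exact: df.
rewrite (deriveD (f := a *: f))//; first by rewrite deriveZ.
  exact: derivableZ.
by apply: diff_derivable; exact: dg.
Qed.

Lemma Ck_coord n U k (F : V -> 'rV[R]_n) i : open U ->
  Ck k U F -> Ck k U (fun x => F x 0 i).
Proof.
elim: k F => [|k IH] F oU /=.
  move=> cF x Ux.
  apply: (@continuous_comp _ _ _ F (fun N : 'rV[R]_n => N 0 i)); first exact: cF.
  exact: coord_continuous.
move=> [dF DF]; split=> [x Ux|v].
  apply: (@differentiable_comp _ _ _ _ F (fun N : 'rV[R]_n => N 0 i)).
    exact: dF.
  exact: differentiable_coord.
apply: (Ck_ext oU _ (IH _ oU (DF v))) => x Ux.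
by rewrite derive_mx ?mxE//; apply: diff_derivable; exact: dF.
Qed.

End ClassCk.

(** * Vector fields and their action on functions *)

Section Manifold.
Variables (R : realType) (n : nat) (M : topologicalType).
Variable A : smooth_structure R n M.
Implicit Types (U V K : set M) (f g : M -> R) (p q : M).

Local Notation ch p := (chart_at A p).
(* the extended reals have a [contract] too *)
Local Notation contract := Defs.contract.

Lemma cinv_near (c : chart R n M) V p : open V -> V p -> cdom c p ->
  \forall x \near cmap c p, V (cinv c x).
Proof.
move=> oV Vp cp; apply: (cinv_cts cp).
by rewrite cmapK//; apply: open_nbhs_nbhs; split.
Qed.

Lemma open_chart_image (c : chart R n M) V :
  open V -> open (cmap c @` (V `&` cdom c)).
Proof.
move=> oV; rewrite openE => _ [p [Vp cp] <-]; rewrite /interior.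
have : \forall x \near cmap c p, (cmap c @` cdom c) x.
  by apply: open_nbhs_nbhs; split; [exact: cimg_open|exists p].
apply: filterS2 (cinv_near oV Vp cp) => x Vx [q cq xq].
by rewrite -xq cmapK// in Vx *; exists q.
Qed.

Lemma smooth_on_ext U f g : open U -> (forall p, U p -> f p = g p) ->
  smooth_on A U f -> smooth_on A U g.
Proof.
move=> oU fg sf k p; apply: (Ck_ext (open_chart_image oU) _ (sf k p)).
by move=> _ [q [Uq cq] <-] /=; rewrite cmapK// fg.
Qed.

Lemma smooth_on_sub U V f : V `<=` U -> smooth_on A U f -> smooth_on A V f.
Proof.
move=> VU sf k p; apply: Ck_sub (sf k p).
by move=> _ [q [Vq cq] <-]; exists q => //; split=> //; exact: VU.
Qed.

Lemma smooth_on_cst U a : open U -> smooth_on A U (fun=> a).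
Proof. by move=> oU k p; apply: Ck_cst; exact: open_chart_image. Qed.

Lemma smooth_on_lincomb U m (c : 'I_m -> R) (f : 'I_m -> M -> R) : open U ->
  (forall i, smooth_on A U (f i)) ->
  smooth_on A U (fun p => \sum_i c i * f i p).
Proof.
move=> oU sf; elim: m c f sf => [|m IH] c f sf.
  by apply: smooth_on_ext (smooth_on_cst 0 oU) => // p _; rewrite big_ord0.
have := IH (fun i => c (lift ord0 i)) _ (fun i => sf (lift ord0 i)).
move=> s; apply: (@smooth_on_ext _
    (fun p => c ord0 * f ord0 p + \sum_i c (lift ord0 i) * f (lift ord0 i) p)).
- exact: oU.
- by move=> p _; rewrite big_ord_recl.
- by move=> k p; apply: (CkZD _ (open_chart_image oU) (sf ord0 k p) (s k p)).
Qed.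

Lemma smooth_on_differentiable U f p : smooth_on A U f -> U p ->
  differentiable (f \o cinv (ch p)) (cmap (ch p) p).
Proof.
move=> sf Up; have [df _] := sf 1%N p; apply: df.
by exists p => //; split => //; exact: mem_chart_at.
Qed.

Lemma smooth_on_derivable U f p v : smooth_on A U f -> U p ->
  is_derive (cmap (ch p) p) v (f \o cinv (ch p)) (dirder A p v f).
Proof.
move=> sf Up; apply: derivableP; apply: diff_derivable.
exact: smooth_on_differentiable sf Up.
Qed.

Lemma dirder_ext U f g p v : open U -> U p -> (forall q, U q -> f q = g q) ->
  dirder A p v f = dirder A p v g.
Proof.
move=> oU Up fg; apply: near_eq_derive.
by apply: filterS (cinv_near oU Up (mem_chart_at A p)) => x /fg.
Qed.

Lemma dirder_lincomb U m (c : 'I_m -> R) (u : 'I_m -> 'rV[R]_n) f p :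
  smooth_on A U f -> U p ->
  dirder A p (\sum_i c i *: u i) f = \sum_i c i * dirder A p (u i) f.
Proof.
move=> sf Up; have df := smooth_on_differentiable sf Up.
rewrite /dirder deriveE// linear_sum; apply: eq_bigr => i _.
by rewrite linearZ/= deriveE.
Qed.

Lemma dirder_addv U u v f p : smooth_on A U f -> U p ->
  dirder A p (u + v) f = dirder A p u f + dirder A p v f.
Proof.
move=> sf Up; have df := smooth_on_differentiable sf Up.
by rewrite /dirder !deriveE// linearD.
Qed.

Lemma dirder_sum_mul U m (y f : 'I_m -> M -> R) p v :
  (forall i, smooth_on A U (y i)) -> (forall i, smooth_on A U (f i)) -> U p ->
  dirder A p v (fun q => \sum_i y i q * f i q) =
  \sum_i (dirder A p v (y i) * f i p + y i p * dirder A p v (f i)).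
Proof.
move=> sy sf Up.
have [_] := is_derive_bigsum (fun i => is_derive_mul
  (smooth_on_derivable v (sy i) Up) (smooth_on_derivable v (sf i) Up)).
by rewrite /= (cmapK (mem_chart_at A p)).
Qed.

Lemma dirderB U f g p v : smooth_on A U f -> smooth_on A U g -> U p ->
  dirder A p v (fun q => f q - g q) = dirder A p v f - dirder A p v g.
Proof.
move=> sf sg Up.
by have [] := is_deriveB (smooth_on_derivable v sf Up) (smooth_on_derivable v sg Up).
Qed.

Lemma dirder_cst p v a : dirder A p v (fun=> a) = 0.
Proof. exact: (derive_cst a (cmap (ch p) p) v). Qed.

Lemma dirder_fun_lincomb U m (c : 'I_m -> R) (f : 'I_m -> M -> R) p v : open U ->
  (forall i, smooth_on A U (f i)) -> U p ->
  dirder A p v (fun q => \sum_i c i * f i q) = \sum_i c i * dirder A p v (f i).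
Proof.
move=> oU sf Up.
rewrite (dirder_sum_mul v (fun i => smooth_on_cst (c i) oU) sf Up).
by apply: eq_bigr => i _; rewrite dirder_cst mul0r add0r.
Qed.

Lemma smooth_coord p i :
  smooth_on A (cdom (ch p)) (fun q => cmap (ch p) q 0 i).
Proof.
move=> k q; have := @chart_compat _ _ _ A q p k; rewrite setIC.
by apply: Ck_coord; apply: open_chart_image; exact: cdom_open.
Qed.

Lemma dirder_coord p v i : dirder A p v (fun q => cmap (ch p) q 0 i) = v 0 i.
Proof.
have -> : v 0 i = 'D_v (fun x : 'rV[R]_n => x 0 i) (cmap (ch p) p).
  have /derive_mx : derivable (@id 'rV[R]_n) (cmap (ch p) p) v.
    exact: derivable_id.
  by rewrite derive_id => /matrixP/(_ 0 i); rewrite mxE.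
apply: near_eq_derive.
have : \forall x \near cmap (ch p) p, (cmap (ch p) @` cdom (ch p)) x.
  apply: open_nbhs_nbhs; split; first exact: cimg_open.
  by exists p => //; exact: mem_chart_at.
by apply: filterS => _ [q cq <-] /=; rewrite cmapK.
Qed.

(** Tangent vectors are separated by the coordinate functions of the chart, which
    are smooth only on its domain: hence the quantification over the smaller
    open sets [W]. *)
Lemma dirder_inj V p (u v : 'rV[R]_n) : open V -> V p ->
  (forall W f, open W -> W `<=` V -> W p -> smooth_on A W f ->
     dirder A p u f = dirder A p v f) -> u = v.
Proof.
move=> oV Vp uv; apply/rowP => i; rewrite -!(dirder_coord p).
apply: (uv (V `&` cdom (ch p))).
- by apply: openI => //; exact: cdom_open.
- exact: subIsetl.
- by split=> //; exact: mem_chart_at.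
- exact: smooth_on_sub (@subIsetr _ _ _) (smooth_coord p i).
Qed.

Lemma vact_lincomb V m (c : 'I_m -> R) (X : 'I_m -> vfield R n M) f p :
  smooth_on A V f -> V p ->
  vact A (fun q => \sum_i c i *: X i q) f p = \sum_i c i * vact A (X i) f p.
Proof. by move=> sf Vp; exact: dirder_lincomb sf Vp. Qed.

Lemma smooth_vf_sub U V (X : vfield R n M) :
  V `<=` U -> smooth_vf A U X -> smooth_vf A V X.
Proof. by move=> VU sX W f oW WV; apply: sX => // q /WV /VU. Qed.

Lemma smooth_vf_lincomb U m (c : 'I_m -> R) (X : 'I_m -> vfield R n M) :
  (forall i, smooth_vf A U (X i)) ->
  smooth_vf A U (fun q => \sum_i c i *: X i q).
Proof.
move=> sX V f oV VU sf.
have := smooth_on_lincomb c oV (fun i => sX i V f oV VU sf).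
by apply: smooth_on_ext => // p Vp; rewrite (vact_lincomb c X sf Vp).
Qed.

(** * The structure constants of the invariant frame *)

Section Frame.
Variables (K : set M) (C : 'I_n -> 'I_n -> 'I_n -> R).
Variable X : 'I_n -> vfield R n M.
Hypothesis K_open : open K.
Hypothesis X_frame : frame_over A K X.
Hypothesis X_bracket : forall B D,
  is_bracket A K (X B) (X D) (fun p => - \sum_P C P B D *: X P p).

Let sX B V f : open V -> V `<=` K -> smooth_on A V f ->
  smooth_on A V (vact A (X B) f).
Proof. by move=> oV VK; case: X_frame => + _; apply. Qed.

Lemma frame_bracket V f p B D : open V -> V `<=` K -> smooth_on A V f -> V p ->
  vact A (X B) (vact A (X D) f) p - vact A (X D) (vact A (X B) f) p =
  - \sum_P C P B D * vact A (X P) f p.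
Proof.
move=> oV VK sf Vp; rewrite -(X_bracket B D oV VK sf Vp).
transitivity (vact A (fun q => \sum_P (- C P B D) *: X P q) f p).
  rewrite /vact; congr (dirder A p _ f).
  by rewrite -sumrN; apply: eq_bigr => P _; rewrite scaleNr.
rewrite (vact_lincomb _ _ sf Vp) -sumrN.
by apply: eq_bigr => P _; rewrite mulNr.
Qed.

Lemma frame_free p (c : 'I_n -> R) : K p ->
  (forall V f, open V -> V `<=` K -> V p -> smooth_on A V f ->
     \sum_P c P * vact A (X P) f p = 0) -> forall P, c P = 0.
Proof.
move=> Kp c0; pose Xm : 'M[R]_n := \matrix_B X B p.
have Xu : Xm \in unitmx by case: X_frame => _; apply.
have : (\row_P c P) *m Xm = 0.
  rewrite mulmx_sum_row; under eq_bigr do rewrite mxE rowK.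
  apply: (dirder_inj K_open Kp) => W f oW WK Wp sf.
  rewrite (dirder_lincomb c (fun i => X i p) sf Wp) [LHS](c0 W f)//.
  by have := dirder_lincomb (fun=> 0) (fun i => X i p) sf Wp;
    rewrite !big1 // => i _; rewrite ?scale0r ?mul0r.
move/(canRL (mulmxK Xu)); rewrite mul0mx => /rowP c0' P.
by have := c0' P; rewrite !mxE.
Qed.

Lemma frame_sc_antisym p : K p -> forall P B D, C P B D = - C P D B.
Proof.
move=> Kp P B D; apply/eqP; rewrite -addr_eq0; apply/eqP; move: P.
apply: (@frame_free p (fun P => C P B D + C P D B)) => // V f oV VK Vp sf.
under eq_bigr do rewrite mulrDl; rewrite big_split /=.
apply: oppr_inj; rewrite opprD oppr0.
rewrite -!(frame_bracket _ _ oV VK sf Vp).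
by rewrite addrA subrK subrr.
Qed.

Lemma frame_act_bracket V f p B D E :
  open V -> V `<=` K -> smooth_on A V f -> V p ->
  vact A (X B) (vact A (X D) (vact A (X E) f)) p -
  vact A (X B) (vact A (X E) (vact A (X D) f)) p =
  - \sum_P C P D E * vact A (X B) (vact A (X P) f) p.
Proof.
move=> oV VK sf Vp; have sx P : smooth_on A V (vact A (X P) f) by exact: sX.
rewrite -(dirderB _ (sX D oV VK (sx E)) (sX E oV VK (sx D)) Vp).
rewrite -sumrN; under [RHS]eq_bigr do rewrite -mulNr.
rewrite -(dirder_fun_lincomb _ _ oV sx Vp).
apply: (dirder_ext _ oV Vp) => q Vq; rewrite (frame_bracket _ _ oV VK sf Vq).
by rewrite -sumrN; apply: eq_bigr => P _; rewrite mulNr.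
Qed.

(** Expanding the double commutators [[X_B, [X_D, X_E]] f] and summing over the
    cyclic permutations, the twelve third-order terms cancel in pairs; a
    combination of frame fields that kills every function has zero
    coefficients. *)
Lemma frame_sc_jacobi p : K p -> forall B D E Q,
  \sum_P C P D E * C Q B P + \sum_P C P E B * C Q D P +
  \sum_P C P B D * C Q E P = 0.
Proof.
move=> Kp B D E Q; move: Q.
apply: (@frame_free p (fun Q => \sum_P C P D E * C Q B P +
  \sum_P C P E B * C Q D P + \sum_P C P B D * C Q E P)) => // V f oV VK Vp sf.
(* abstracting the action keeps rewriting from unfolding the derivatives *)
have [x xE] : exists x : 'I_n -> (M -> R) -> M -> R, x = fun B => vact A (X B).
  by eexists.
have double B' D' E' : \sum_Q (\sum_P C P D' E' * C Q B' P) * x Q f p =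
    x B' (x D' (x E' f)) p - x B' (x E' (x D' f)) p
    - (x D' (x E' (x B' f)) p - x E' (x D' (x B' f)) p).
  have E1 : x B' (x D' (x E' f)) p - x B' (x E' (x D' f)) p =
      - \sum_P C P D' E' * x B' (x P f) p.
    by rewrite xE; exact: frame_act_bracket oV VK sf Vp.
  have E2 : x D' (x E' (x B' f)) p - x E' (x D' (x B' f)) p =
      - \sum_P C P D' E' * x P (x B' f) p.
    by rewrite xE; exact: (frame_bracket D' E' oV VK (sX B' oV VK sf) Vp).
  have E3 P : x B' (x P f) p - x P (x B' f) p = - \sum_Q C Q B' P * x Q f p.
    by rewrite xE; exact: (frame_bracket B' P oV VK sf Vp).
  rewrite E1 E2 opprK addrC -sumrB.
  under eq_bigr do rewrite mulr_suml.
  rewrite exchange_big /=; apply: eq_bigr => P _.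
  under eq_bigr do rewrite -mulrA.
  by rewrite -mulr_sumr -mulrBr -[in RHS]opprB E3 opprK.
have cyclic (a b c d e g : R) :
  a - b - (c - d) + (c - e - (g - b)) + (g - d - (a - e)) = 0 by ring.
suff : \sum_P (\sum_Q C Q D E * C P B Q + \sum_Q C Q E B * C P D Q +
    \sum_Q C Q B D * C P E Q) * x P f p = 0 by rewrite xE.
under eq_bigr do rewrite !mulrDl.
by rewrite !big_split /= !double cyclic.
Qed.

(** * Lie derivatives of the coframe along constant combinations of the frame *)

Variable sigma : 'I_n -> cofield R n M.
Hypothesis sigma_dual : dual_coframe A K X sigma.

Lemma contract_lincomb m (c : 'I_m -> R) (Y : 'I_m -> vfield R n M) t p :
  contract (fun q => \sum_i c i *: Y i q) t p = \sum_i c i * contract (Y i) t p.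
Proof.
rewrite /contract mulmx_suml summxE; apply: eq_bigr => i _.
by rewrite -scalemxAl mxE.
Qed.

Lemma contract_frame_lincomb (c : 'I_n -> R) B p : K p ->
  contract (fun q => \sum_D c D *: X D q) (sigma B) p = c B.
Proof.
move=> Kp; case: sigma_dual => _ dual; rewrite contract_lincomb.
rewrite (bigD1 B)//= dual// eqxx mulr1 big1 ?addr0// => D DB.
by rewrite dual// (negPf DB) mulr0.
Qed.

(** A right inverse of a square matrix is a left inverse: this turns the duality
    of frame and coframe into a decomposition of the identity. *)
Lemma frame_decomposition (Y : vfield R n M) p : K p ->
  Y p = \sum_E contract Y (sigma E) p *: X E p.
Proof.
move=> Kp; case: sigma_dual => _ dual.
pose Xm : 'M[R]_n := \matrix_B X B p.
pose Sm : 'M[R]_n := \matrix_(i, j) sigma j p i 0.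
have YSm (u : 'rV[R]_n) E : (u *m Sm) 0 E = (u *m sigma E p) 0 0.
  by rewrite !mxE; apply: eq_bigr => j _; rewrite mxE.
have /mulmx1C SX : Xm *m Sm = 1%:M.
  apply/row_matrixP => B; rewrite row_mul rowK row1; apply/rowP => D.
  by rewrite YSm [LHS](dual _ Kp) mxE eqxx eq_sym.
rewrite -[LHS]mulmx1 -SX mulmxA mulmx_sum_row.
by apply: eq_bigr => E _; rewrite rowK YSm.
Qed.

Definition frame_lincomb (s : 'I_n -> R) : vfield R n M :=
  fun p => \sum_D s D *: X D p.

(** The matrix of the inner derivation [ad s] in the indices of [C]. *)
Definition ad_coef (s : 'I_n -> R) P E := \sum_D s D * C P D E.

Lemma lincomb_frame_bracket (s : 'I_n -> R) E :
  is_bracket A K (frame_lincomb s) (X E)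
    (fun p => \sum_P (- ad_coef s P E) *: X P p).
Proof.
move=> V f oV VK sf p Vp; rewrite (vact_lincomb _ _ sf Vp).
have sx B : smooth_on A V (vact A (X B) f) by exact: sX.
rewrite (vact_lincomb _ _ (sx E) Vp).
have -> : vact A (X E) (vact A (frame_lincomb s) f) p =
    \sum_D s D * vact A (X E) (vact A (X D) f) p.
  rewrite -(dirder_fun_lincomb _ _ oV sx Vp).
  by apply: (dirder_ext _ oV Vp) => q Vq; rewrite (vact_lincomb _ _ sf Vq).
rewrite -sumrB; under [RHS]eq_bigr do
  rewrite -mulrBr (frame_bracket _ _ oV VK sf Vp) mulrN mulr_sumr.
rewrite sumrN exchange_big /= -sumrN; apply: eq_bigr => P _.
rewrite mulNr /ad_coef mulr_suml; congr (- _).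
by apply: eq_bigr => D _; rewrite mulrA.
Qed.

(** The direct implication tests the Lie derivative on the frame fields, where
    [sigma B] has constant values. For the converse, a general [Y] is
    [y^E X_E] with [y^E] its pairing with [sigma E], and the Leibniz rule
    determines its bracket with [frame_lincomb s]:
    [Y' = (frame_lincomb s y^E) X_E - y^E ad^P_E X_P]. *)
Lemma lie_coframe_lincomb p0 (s l : 'I_n -> R) B : K p0 ->
  is_lie_cofield A K (frame_lincomb s) (sigma B)
    (fun p => \sum_D l D *: sigma D p) <->
  forall E, l E = ad_coef s B E.
Proof.
have contractE Y q : contract Y (fun p => \sum_D l D *: sigma D p) q =
    \sum_D l D * contract Y (sigma D) q.
  rewrite /contract mulmx_sumr summxE; apply: eq_bigr => i _.
  by rewrite -scalemxAr mxE.
move=> Kp0; have [_ dual] := sigma_dual; split=> [lie E | lE].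
  have sXE : smooth_vf A K (X E) by case: X_frame.
  have sY' : smooth_vf A K (fun p => \sum_P (- ad_coef s P E) *: X P p).
    by apply: smooth_vf_lincomb; case: X_frame.
  have := lie K _ _ K_open (@subset_refl _ K) sXE sY'
    (lincomb_frame_bracket s E) p0 Kp0.
  rewrite contractE contract_frame_lincomb// opprK.
  have -> : vact A (frame_lincomb s) (contract (X E) (sigma B)) p0 = 0.
    rewrite -(dirder_cst p0 (frame_lincomb s p0) (E == B)%:R).
    by apply: (dirder_ext _ K_open Kp0) => q Kq; exact: dual.
  rewrite add0r => <-; rewrite (bigD1 E)//= dual// eqxx mulr1 big1 ?addr0//.
  by move=> D DE; rewrite dual// eq_sym (negPf DE) mulr0.
move=> V Y Y' oV VK sY sY' brYY' p Vp; have Kp := VK _ Vp.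
pose y E := contract Y (sigma E).
have sy E : smooth_on A V (y E) by case: sigma_dual => + _; apply.
pose Z E : vfield R n M := fun p => \sum_P (- ad_coef s P E) *: X P p.
have Y'E : Y' p = \sum_E vact A (frame_lincomb s) (y E) p *: X E p +
    \sum_E y E p *: Z E p.
  apply: (dirder_inj oV Vp) => W f oW WV Wp sf.
  have WK := subset_trans WV VK.
  have sx E : smooth_on A W (vact A (X E) f) by exact: sX.
  have syW E : smooth_on A W (y E) := smooth_on_sub WV (sy E).
  have sPf : smooth_on A W (vact A (frame_lincomb s) f).
    apply: smooth_vf_lincomb oW (@subset_refl _ W) sf => D.
    by apply: smooth_vf_sub WK _; case: X_frame.
  rewrite [LHS](brYY' W f oW WV sf p Wp).
  have -> : vact A (frame_lincomb s) (vact A Y f) p = \sum_E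
      (vact A (frame_lincomb s) (y E) p * vact A (X E) f p +
       y E p * vact A (frame_lincomb s) (vact A (X E) f) p).
    rewrite -(dirder_sum_mul _ syW sx Wp).
    apply: (dirder_ext _ oW Wp) => q Wq.
    rewrite -(dirder_lincomb (fun E => y E q) (fun E => X E q) sf Wq).
    by rewrite -frame_decomposition//; exact: WK.
  have -> : vact A Y (vact A (frame_lincomb s) f) p =
      \sum_E y E p * vact A (X E) (vact A (frame_lincomb s) f) p.
    rewrite -(dirder_lincomb (fun E => y E p) (fun E => X E p) sPf Wp).
    by rewrite -frame_decomposition.
  rewrite (dirder_addv _ _ sf Wp).
  rewrite (dirder_lincomb _ (fun E => X E p) sf Wp).
  rewrite (dirder_lincomb _ (fun E => Z E p) sf Wp).
  rewrite -sumrB -big_split; apply: eq_bigr => E _ /=.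
  rewrite -addrA; congr (_ + _).
  rewrite -mulrBr; congr (_ * _).
  exact: esym (lincomb_frame_bracket s E oW WK sf Wp).
rewrite contractE.
have -> : contract Y' (sigma B) p = vact A (frame_lincomb s) (y B) p -
    \sum_E y E p * ad_coef s B E.
  rewrite /contract Y'E mulmxDl mxE; congr (_ + _).
    exact: (contract_frame_lincomb (fun E => vact A (frame_lincomb s) (y E) p)).
  apply: etrans (contract_lincomb (fun E => y E p) Z (sigma B) p) _.
  rewrite -sumrN.
  by apply: eq_bigr => E _; rewrite contract_frame_lincomb// mulrN.
rewrite subKr; apply: eq_bigr => E _.
by rewrite lE mulrC.
Qed.

(** For each [s^D] this is the Jacobi identity, rearranged with the antisymmetry
    of the lower indices. *)
Lemma ad_coef_sc_generator p0 (s : 'I_n -> R) : K p0 ->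
  sc_generator C (\matrix_(P, E) ad_coef s P E).
Proof.
move=> Kp0 B P Q.
have sumE (u v : 'I_n -> 'I_n) (c : 'I_n -> R) :
    \sum_E (\matrix_(P, E) ad_coef s P E) (u E) (v E) * c E =
    \sum_D s D * \sum_E C (u E) D (v E) * c E.
  under eq_bigr do rewrite mxE mulr_suml.
  rewrite exchange_big /=; apply: eq_bigr => D _; rewrite mulr_sumr.
  by apply: eq_bigr => E _; rewrite mulrA.
rewrite (sumE (fun=> B) id) (sumE id (fun=> P)) (sumE id (fun=> Q)) -big_split.
apply: eq_bigr => D _ /=; rewrite -mulrDr; congr (_ * _); apply/eqP.
rewrite -subr_eq0 opprD; apply/eqP.
apply: etrans _ (frame_sc_jacobi Kp0 D P Q B).
rewrite [- _ + _]addrC addrA; congr (_ + _ + _).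
- by apply: eq_bigr => E _; rewrite mulrC.
- rewrite -sumrN; apply: eq_bigr => E _.
  by rewrite (frame_sc_antisym Kp0 E Q D) mulNr.
rewrite -sumrN; apply: eq_bigr => E _.
by rewrite (frame_sc_antisym Kp0 B Q E) mulrN.
Qed.

End Frame.
End Manifold.

(** * The family of frame metrics *)

(** The minus signs of the expansion of the metric are absorbed in [- Sig]. *)
Lemma frame_metric_variation (R : realType) (n r : nat)
    (C : 'I_n -> 'I_n -> 'I_n -> R) (h : 'M[R]_n) (Sig : 'M[R]_(r, n))
    (w : 'rV[R]_r) (P Q : 'I_n) :
  let L := lin_comb (fun a => \matrix_(B, E) ad_coef C (Sig a) B E) w in
  let eps N := \sum_a w 0 a * (- Sig) a N in
  (h - L^T *m h - h *m L) P Q =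
  h P Q + \sum_S \sum_N h P S * C S N Q * eps N
        + \sum_S \sum_N h S Q * C S N P * eps N.
Proof.
move=> L eps.
have LE S E : \sum_N C S N E * eps N = - L S E.
  rewrite summxE -sumrN; under eq_bigr do rewrite mulr_sumr.
  rewrite exchange_big; apply: eq_bigr => a _ /=.
  rewrite !mxE mulr_sumr -sumrN; apply: eq_bigr => N _.
  by rewrite !mxE; ring.
rewrite addrAC !mxE; congr (_ + _ + _); rewrite -sumrN; apply: eq_bigr => S _.
  by under [RHS]eq_bigr do rewrite -mulrA; rewrite -mulr_sumr LE mulrN.
under [RHS]eq_bigr do rewrite -mulrA; rewrite -mulr_sumr LE mulrN.
by rewrite !mxE mulrC.
Qed.

Theorem proposition3p1p1 (R : realType) (n m r : nat) (M : topologicalType)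
    (A : smooth_structure R n M) (T : Type) (g : T -> ctensor2 R n M)
    (h : T -> 'M[R]_n) (G : local_lie_group R n) (Phi : local_action A G)
    (xi X : 'I_n -> vfield R n M) (sigma : 'I_n -> cofield R n M)
    (C : 'I_n -> 'I_n -> 'I_n -> R) (K : set M) (p0 : M)
    (m_gt0 : (0 < m)%N)
    (hom : locally_homogeneous m g h Phi xi C)
    (K_open : open K) (K_p0 : K p0)
    (X_frame : invariant_frame A K C xi X)
    (sigma_dual : dual_coframe A K X sigma)
    (g_red : forall t q, K q ->
       g t q = \sum_P \sum_Q h t P Q *: tensor (sigma P) (sigma Q) q) :
  irreducible_frame_metrics (r := r) A K C X sigma h =
  [set H : T -> 'rV[R]_r -> 'M[R]_n |
     exists f : T -> 'M[R]_(r, n), forall (t : T) (w : 'rV[R]_r),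
       let eps N := \sum_a w 0 a * f t a N in
       forall P Q : 'I_n,
         H t w P Q =
           h t P Q + \sum_S \sum_N h t P S * C S N Q * eps N
                   + \sum_S \sum_N h t S Q * C S N P * eps N].
Proof.
have X_bracket := if_bracket X_frame.
have frame_X := if_frame X_frame.
have lieP s l B := lie_coframe_lincomb K_open frame_X X_bracket sigma_dual s l B K_p0.
apply/seteqP; split=> H.
  move=> [Sig [lam Hlam]]; exists (fun t => - Sig t) => t w eps P Q.
  have [lie /first_order_frame_metricP[_ ->]] := Hlam t.
  rewrite -frame_metric_variation.
  have -> // : lam t = fun a => \matrix_(B, E) ad_coef C (Sig t a) B E.
  apply/funext => a; apply/matrixP => B E; rewrite mxE.
  exact: (lieP (Sig t a) (lam t a B) B).1 (lie a B) E.
move=> [f Hf].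
exists (fun t => - f t), (fun t a => \matrix_(B, E) ad_coef C ((- f t) a) B E) => t.
split=> [a B|].
  by apply/(lieP ((- f t) a)) => E; rewrite mxE.
apply/first_order_frame_metricP; split=> [a|w].
  exact: ad_coef_sc_generator K_open frame_X X_bracket _ _ K_p0.
apply/matrixP => P Q; rewrite Hf.
by have := frame_metric_variation C (h t) (- f t) w P Q; rewrite opprK.
Qed.
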